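(* Let $\mathbf{\Phi}\in\mathbb{R}^{m\times n}$ be a measurement matrix, let $\mathbf{x}\in\mathbb{R}^n$ be any $K$-sparse signal with support $T=\mathrm{supp}(\mathbf{x})$, and let $\mathbf{y}=\mathbf{\Phi}\mathbf{x}$. Run OMP on $(\mathbf{y},\mathbf{\Phi})$ (with $c>1$ a constant, as in OMP$_{cK}$), producing estimated supports $T^0=\emptyset\subseteq T^1\subseteq T^2\subseteq\cdots$. For an integer $k$ with $0\le k\le\lceil cK\rceil$, let $N^k=|T\setminus T^k|$ be the number of support indices not yet selected after $k$ iterations. Then $T\subseteq T^{k+\lceil cN^k\rceil}$ provided $$c\;\ge\;-\frac{4(1+\delta_1)}{1-\delta_s}\,\log\!\left(\frac12-\frac12\sqrt{\frac{\delta_{N^k}+\delta_s}{1+\delta_{N^k}}}\right),$$ where $s=|T\cup T^{k+\lfloor cN^k\rfloor}|$ and $\log$ is the natural logarithm.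
   Context: Orthogonal matching pursuit (OMP): given $\mathbf{y}\in\mathbb{R}^m$ and $\mathbf{\Phi}\in\mathbb{R}^{m\times n}$ with columns $\phi_1,\dots,\phi_n$, set $T^0=\emptyset$, $\mathbf{r}^0=\mathbf{y}$, and for $k=1,2,\dots$: choose $t^k\in\arg\max_{i\in\{1,\dots,n\}}|\langle \mathbf{r}^{k-1},\phi_i\rangle|$; set $T^k=T^{k-1}\cup\{t^k\}$; let $\hat{\mathbf{x}}^k=\arg\min_{\mathbf{u}:\,\mathrm{supp}(\mathbf{u})=T^k}\|\mathbf{y}-\mathbf{\Phi}\mathbf{u}\|_2$; set $\mathbf{r}^k=\mathbf{y}-\mathbf{\Phi}\hat{\mathbf{x}}^k$. OMP$_{cK}$ denotes OMP run for $\lceil cK\rceil$ (or more) iterations with a constant $c>1$. A vector is $K$-sparse if it has at most $K$ nonzero entries. The restricted isometry constant $\delta_j$ of $\mathbf{\Phi}$ is the smallest $\delta\ge0$ such that $(1-\delta)\|\mathbf{v}\|_2^2\le\|\mathbf{\Phi}\mathbf{v}\|_2^2\le(1+\delta)\|\mathbf{v}\|_2^2$ for every $j$-sparse $\mathbf{v}\in\mathbb{R}^n$. *)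

(* Defs.v *)
From HB Require Import structures.
From mathcomp Require Import all_boot all_order all_algebra.
From mathcomp Require Import all_classical all_reals all_analysis.
Set Implicit Arguments. Unset Strict Implicit. Unset Printing Implicit Defensive.
Import Order.TTheory GRing.Theory Num.Theory.
Local Open Scope ring_scope.

Section OMPDefs.
Variable R : realType.

Definition supp n (v : 'cV[R]_n) : {set 'I_n} := [set i | v i 0 != 0].

Definition sparse n (j : nat) (v : 'cV[R]_n) : Prop := (#|supp v| <= j)%N.

Definition sqnorm m (v : 'cV[R]_m) : R := \sum_i v i 0 ^+ 2.
Definition inner m (v w : 'cV[R]_m) : R := \sum_i v i 0 * w i 0.

Definition ric m n (Phi : 'M[R]_(m, n)) (j : nat) : R :=
  inf [set d : R | 0 <= d /\
        forall v : 'cV[R]_n, sparse j v ->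
          (1 - d) * sqnorm v <= sqnorm (Phi *m v) /\
          sqnorm (Phi *m v) <= (1 + d) * sqnorm v].

(* estimated support after k iterations: T^k = {t 0, ..., t (k-1)},
   where t i is the index selected at iteration i+1 *)
Definition Tset n (t : nat -> 'I_n) (k : nat) : {set 'I_n} :=
  [set t (nat_of_ord i) | i : 'I_k].

(* An (infinite) run of OMP on (y, Phi):
   u k is the least-squares estimate xhat^k supported on T^k,
   the residual is r^k = y - Phi u k, and t k (= t^{k+1}) maximizes
   |<r^k, phi_i>| over all columns i. *)
Definition omp_run m n (Phi : 'M[R]_(m, n)) (y : 'cV[R]_m)
    (t : nat -> 'I_n) (u : nat -> 'cV[R]_n) : Prop :=
  forall k : nat,
    [/\ supp (u k) \subset Tset t k,
        (forall w : 'cV[R]_n, supp w \subset Tset t k ->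
           sqnorm (y - Phi *m u k) <= sqnorm (y - Phi *m w))
      & (forall i : 'I_n,
           `|inner (y - Phi *m u k) (col i Phi)|
             <= `|inner (y - Phi *m u k) (col (t k) Phi)|)].

End OMPDefs.

(* Main.v *)
(** Put [eta = exp (- c (1 - delta_s) / (4 (1 + delta_1)))].  The bound on [c]
    says exactly that [eta <= 1/2] and
    [4 eta (1 - eta) (1 + delta_N) <= 1 - delta_s].

    Let [G = T \ T^k], [N = |G|], and let [e_i] be the energy of [x] on [G]
    without its [2^i - 1] largest entries.  Comparing the residual with that of
    the vector missing only these light entries, about [c (2^i - 1) / 4]
    iterations give
    [|r_i|^2 <= (1 - eta) (1 + delta_N) e_i + eta |r_(i-1)|^2].
    As long as [e_i >= 2 eta e_(i-1)], this preserves
    [|r_i|^2 <= 2 (1 - eta) (1 + delta_N) e_i].  At the first [L] with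
    [e_(L+1) < 2 eta e_L] it gives [|r_(L+1)|^2 < (1 - delta_s) e_L], so by
    restricted isometry the energy of [x] outside the current support is below
    [e_L], which forces at least [2^L] further indices of [T] to have been
    selected.  This cost at most [c 2^L] iterations, so induction on [N]
    finishes within [c N] iterations. *)

Require Import Defs.
From HB Require Import structures.
From mathcomp Require Import all_boot all_order all_algebra.
From mathcomp Require Import all_classical all_reals all_analysis.
From mathcomp Require Import ring lra.
Set Implicit Arguments.
Unset Strict Implicit.
Unset Printing Implicit Defensive.
Import Order.TTheory GRing.Theory Num.Theory.
Local Open Scope ring_scope.

(** * Euclidean inner products and norms of column vectors *)

Section InnerProduct.
Variable R : realType.
Implicit Types m n : nat.

Lemma sqnorm_ge0 m (v : 'cV[R]_m) : 0 <= sqnorm v.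
Proof. by apply: sumr_ge0 => i _; exact: sqr_ge0. Qed.

Lemma sqnorm_eq0 m (v : 'cV[R]_m) : sqnorm v = 0 -> v = 0.
Proof.
move/eqP; rewrite psumr_eq0 => [/allP v0|i _]; last exact: sqr_ge0.
apply/colP => i; rewrite mxE; apply/eqP; rewrite -sqrf_eq0.
by have := v0 i (mem_index_enum i).
Qed.

Lemma sqnorm0 m : sqnorm (0 : 'cV[R]_m) = 0.
Proof. by rewrite /sqnorm big1 // => i _; rewrite mxE expr0n. Qed.

Lemma sqnormB m (v w : 'cV[R]_m) :
  sqnorm (v - w) = sqnorm v - 2 * inner v w + sqnorm w.
Proof.
rewrite /sqnorm /inner mulr_sumr -sumrB -big_split /=.
by apply: eq_bigr => i _; rewrite !mxE; ring.
Qed.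

Lemma sqnormZ m (a : R) (v : 'cV[R]_m) : sqnorm (a *: v) = a ^+ 2 * sqnorm v.
Proof. by rewrite /sqnorm mulr_sumr; apply: eq_bigr => i _; rewrite mxE exprMn. Qed.

Lemma innerZr m (a : R) (v w : 'cV[R]_m) : inner v (a *: w) = a * inner v w.
Proof. by rewrite /inner mulr_sumr; apply: eq_bigr => i _; rewrite mxE; ring. Qed.

Lemma inner_mulmx m n (Phi : 'M[R]_(m, n)) (r : 'cV[R]_m) (v : 'cV[R]_n) :
  inner r (Phi *m v) = \sum_j v j 0 * inner r (col j Phi).
Proof.
rewrite /inner.
under eq_bigr => i _ do rewrite mxE mulr_sumr.
rewrite exchange_big /=; apply: eq_bigr => j _.
by rewrite mulr_sumr; apply: eq_bigr => i _; rewrite mxE; ring.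
Qed.

(** The difference of the two sides is half the sum of all [(a i * b j - a j * b i) ^+ 2]. *)
Lemma cauchy_schwarz (I : finType) (a b : I -> R) :
  (\sum_i a i * b i) ^+ 2 <= (\sum_i a i ^+ 2) * (\sum_i b i ^+ 2).
Proof.
have -> : (\sum_i a i ^+ 2) * (\sum_i b i ^+ 2) =
    \sum_i \sum_j 2^-1 * ((a i * b j) ^+ 2 + (a j * b i) ^+ 2).
  rewrite [LHS](_ : _ = 2^-1 * (\sum_i \sum_j (a i * b j) ^+ 2 +
      \sum_i \sum_j (a j * b i) ^+ 2)).
    rewrite -big_split mulr_sumr; apply: eq_bigr => i _ /=.
    by rewrite -big_split mulr_sumr.
  have half (z : R) : 2^-1 * (z + z) = z by field.
  rewrite [X in _ + X]exchange_big /= half mulr_suml; apply: eq_bigr => i _.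
  by rewrite mulr_sumr; apply: eq_bigr => j _; rewrite exprMn.
rewrite expr2 mulr_suml; apply: ler_sum => i _.
rewrite mulr_sumr; apply: ler_sum => j _.
have := sqr_ge0 (a i * b j - a j * b i); lra.
Qed.

Lemma sqnorm_mulmx_le m n (Phi : 'M[R]_(m, n)) (v : 'cV[R]_n) :
  sqnorm (Phi *m v) <= (\sum_i \sum_j Phi i j ^+ 2) * sqnorm v.
Proof.
rewrite mulr_suml; apply: ler_sum => i _; rewrite mxE.
exact: cauchy_schwarz.
Qed.

End InnerProduct.

(** * Restricted isometry constants *)

Section RestrictedIsometryConstant.
Variables (R : realType) (m n : nat) (Phi : 'M[R]_(m, n)) (j : nat).

Local Notation ric_set := [set d : R | 0 <= d /\
  forall v : 'cV[R]_n, sparse j v ->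
    (1 - d) * sqnorm v <= sqnorm (Phi *m v) /\
    sqnorm (Phi *m v) <= (1 + d) * sqnorm v]%classic.

Lemma ric_set_nonempty : (ric_set !=set0)%classic.
Proof.
have M0 : 0 <= \sum_i \sum_j Phi i j ^+ 2.
  by do 2!(apply: sumr_ge0 => ? _); exact: sqr_ge0.
(* A constant of at least 1 makes the lower bound trivial; the squared Frobenius norm gives the
   upper one. *)
exists (1 + \sum_i \sum_j Phi i j ^+ 2); split=> [|v _]; first by lra.
have := sqnorm_mulmx_le Phi v; have := sqnorm_ge0 (Phi *m v).
have := mulr_ge0 M0 (sqnorm_ge0 v); have := sqnorm_ge0 v.
by split; lra.
Qed.

Lemma ric_ge0 : 0 <= ric Phi j.
Proof. by apply: lb_le_inf; [exact: ric_set_nonempty|move=> d []]. Qed.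

(** The infimum is attained: for a fixed nonzero [v] each inequality bounds every admissible
    constant from below, hence also their infimum. *)
Lemma ric_bounds (v : 'cV[R]_n) : sparse j v ->
  (1 - ric Phi j) * sqnorm v <= sqnorm (Phi *m v) /\
  sqnorm (Phi *m v) <= (1 + ric Phi j) * sqnorm v.
Proof.
move=> sv; have [v0|vN0] := eqVneq (sqnorm v) 0.
  by rewrite (sqnorm_eq0 v0) mulmx0 !sqnorm0 !mulr0.
have vgt0 : 0 < sqnorm v by rewrite lt_def vN0 sqnorm_ge0.
have lo : 1 - sqnorm (Phi *m v) / sqnorm v <= ric Phi j.
  apply: lb_le_inf; first exact: ric_set_nonempty.
  move=> d [_ /(_ _ sv) [+ _]]; rewrite -ler_pdivlMr //; lra.
have hi : sqnorm (Phi *m v) / sqnorm v - 1 <= ric Phi j.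
  apply: lb_le_inf; first exact: ric_set_nonempty.
  move=> d [_ /(_ _ sv) [_ +]]; rewrite -ler_pdivrMr //; lra.
by split; [rewrite -ler_pdivlMr //|rewrite -ler_pdivrMr //]; lra.
Qed.

End RestrictedIsometryConstant.

Lemma sqnorm_col_le (R : realType) (m n : nat) (Phi : 'M[R]_(m, n)) (i : 'I_n) :
  sqnorm (col i Phi) <= 1 + ric Phi 1.
Proof.
rewrite colE.
have dE j : (delta_mx i 0 : 'cV[R]_n) j 0 = (j == i)%:R by rewrite mxE andbT.
have sd : sparse 1 (delta_mx i 0 : 'cV[R]_n).
  rewrite /sparse; apply: leq_trans (_ : (#|[set i]| <= 1)%N); last by rewrite cards1.
  apply/subset_leq_card/fintype.subsetP => j.
  by rewrite !inE dE pnatr_eq0; case: (j == i).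
have [_] := ric_bounds Phi sd.
suff -> : sqnorm (delta_mx i 0 : 'cV[R]_n) = 1 by rewrite mulr1.
rewrite /sqnorm (bigD1 i) //= dE eqxx expr1n big1 ?addr0 // => j /negbTE jNi.
by rewrite dE jNi expr0n.
Qed.

Lemma Tset_subset (n : nat) (t : nat -> 'I_n) (k l : nat) :
  (k <= l)%N -> Tset t k \subset Tset t l.
Proof.
move=> kl; apply/fintype.subsetP => i /imsetP[j _ ->].
by apply/imsetP; exists (widen_ord kl j).
Qed.

Lemma Tset_last (n : nat) (t : nat -> 'I_n) (k : nat) : t k \in Tset t k.+1.
Proof. by apply/imsetP; exists ord_max. Qed.

(** * Decay of the residual along a run of OMP *)

Section Run.
Variables (R : realType) (m n : nat) (Phi : 'M[R]_(m, n)) (y : 'cV[R]_m).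
Variables (t : nat -> 'I_n) (u : nat -> 'cV[R]_n).
Hypothesis run : omp_run Phi y t u.
Let r l := y - Phi *m u l.

Lemma run_eq0 (l : nat) (i : 'I_n) : i \notin Tset t l -> u l i 0 = 0.
Proof.
have [su _ _] := run l; move=> iNT; apply/eqP; apply: contraNT iNT => ui.
by apply: (fintype.subsetP su); rewrite inE.
Qed.

(** The estimate at [l] does at least as well as [u k] moved along coordinate [i], which is still
    supported in [Tset t l]. *)
Lemma residual_step (i : 'I_n) (k l : nat) : (k <= l)%N -> i \in Tset t l ->
  sqnorm (r l) <= sqnorm (r k) - inner (r k) (col i Phi) ^+ 2 / (1 + ric Phi 1).
Proof.
move=> kl iT; have [sk _ _] := run k; have [_ min_l _] := run l.
set p := inner _ _; set D := 1 + ric Phi 1.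
have D0 : 0 < D by rewrite /D; have := ric_ge0 Phi 1; lra.
(* The step length minimizing [a ^+ 2 * D - 2 * a * p]. *)
pose a := p / D.
have sw : supp (u k + a *: delta_mx i 0) \subset Tset t l.
  apply/fintype.subsetP => j; rewrite inE !mxE andbT.
  have [-> //|_] := eqVneq j i; rewrite mulr0 addr0 => uj.
  apply: (fintype.subsetP (Tset_subset t kl)).
  by apply: (fintype.subsetP sk); rewrite inE.
apply: le_trans (min_l _ sw) _.
rewrite mulmxDr -scalemxAr -colE opprD addrA -/(r k) sqnormB innerZr sqnormZ -/p.
have := ler_wpM2l (sqr_ge0 a) (sqnorm_col_le Phi i); rewrite -/D.
have -> : p ^+ 2 / D = a * p by rewrite /a; field; rewrite gt_eqF.
suff : a ^+ 2 * D = a * p by lra.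
by rewrite /a; field; rewrite gt_eqF.
Qed.

Lemma residual_decr (k l : nat) : (k <= l)%N -> sqnorm (r l) <= sqnorm (r k).
Proof.
move=> kl; have [sk _ _] := run k; have [_ min_l _] := run l.
by apply: min_l; apply: fintype.subset_trans sk (Tset_subset t kl).
Qed.

(** By [residual_step] with [k = l], a nonzero inner product would make the residual smaller than
    itself. *)
Lemma residual_orthogonal (l : nat) (i : 'I_n) :
  i \in Tset t l -> inner (r l) (col i Phi) = 0.
Proof.
move=> iT; have := residual_step (leqnn l) iT.
have D0 : 0 < 1 + ric Phi 1 by have := ric_ge0 Phi 1; lra.
rewrite lerBrDr gerDl pmulr_lle0 ?invr_gt0 // => p0.
by apply/eqP; rewrite -sqrf_eq0 eq_le p0 sqr_ge0.
Qed.

Lemma sq_inner_residual_le (l : nat) (i : 'I_n) :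
  inner (r l) (col i Phi) ^+ 2 <= inner (r l) (col (t l) Phi) ^+ 2.
Proof.
have [_ _ /(_ i)] := run l.
by rewrite -ler_sqr ?nnegrE ?normr_ge0 // !real_normK ?num_real.
Qed.

(* Comparison of the residual with that of a competitor [w] using only [g]
   columns outside the current support.  AM-GM with weight [1 - d] makes the
   quadratic term [sqnorm (w - u l)] cancel against the restricted isometry. *)
Lemma residual_excess_le (l g : nat) (w : 'cV[R]_n) (d : R) :
  d < 1 -> (#|supp w :\: Tset t l| <= g)%N ->
  (1 - d) * sqnorm (w - u l) <= sqnorm (Phi *m (w - u l)) ->
  (1 - d) * (sqnorm (r l) - sqnorm (y - Phi *m w)) <=
    g%:R * inner (r l) (col (t l) Phi) ^+ 2.
Proof.
move=> d1 cardw rip; set v := w - u l in rip *; set M := inner _ _ ^+ 2.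
have -> : y - Phi *m w = r l - Phi *m v.
  by rewrite /r /v mulmxBr opprB addrA subrK.
rewrite (sqnormB (r l)).
suff P : (1 - d) * (2 * inner (r l) (Phi *m v)) <=
    (1 - d) ^+ 2 * sqnorm v + g%:R * M.
  have d1' : 0 <= 1 - d by lra.
  by have := ler_wpM2l d1' rip; lra.
rewrite inner_mulmx.
have M0 : 0 <= M by exact: sqr_ge0.
pose S := supp w :\: Tset t l.
have gM : \sum_(i in S) M <= g%:R * M.
  by rewrite sumr_const -[M *+ _]mulr_natl ler_wpM2r // ler_nat.
apply: le_trans (lerD (lexx _) gM).
rewrite [\sum_(i in S) _]big_mkcond /sqnorm !mulr_sumr -big_split /=.
apply: ler_sum => i _.
(* On the current support orthogonality removes the cross term; elsewhere [u l] vanishes, so only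
   indices of [supp w] contribute. *)
have [iT|iNT] := boolP (i \in Tset t l).
  rewrite residual_orthogonal // mulr0 !mulr0 addr_ge0 //.
    by rewrite mulr_ge0 ?sqr_ge0.
  by case: ifP.
rewrite !inE iNT /= [v i 0]mxE [(- u l) i 0]mxE (run_eq0 iNT) subr0.
have [->|wi] /= := eqVneq (w i 0) 0.
  by rewrite mul0r !mulr0 expr0n mulr0 addr0.
set p := inner _ _.
have pM : p ^+ 2 <= M by exact: sq_inner_residual_le.
by have := sqr_ge0 ((1 - d) * w i 0 - p); lra.
Qed.

(** The greedy column lowers the squared residual by its squared correlation over [1 + ric Phi 1],
    and the excess over the competitor bounds that correlation from below. *)
Lemma residual_contraction (l g : nat) (w : 'cV[R]_n) (d : R) :
  d < 1 -> (0 < g)%N -> (#|supp w :\: Tset t l| <= g)%N ->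
  (1 - d) * sqnorm (w - u l) <= sqnorm (Phi *m (w - u l)) ->
  sqnorm (r l.+1) - sqnorm (y - Phi *m w) <=
    (1 - (1 - d) / ((1 + ric Phi 1) * g%:R)) *
      (sqnorm (r l) - sqnorm (y - Phi *m w)).
Proof.
move=> d1 g0 cardw rip; have := residual_excess_le d1 cardw rip.
have := residual_step (leqnSn l) (Tset_last t l).
set p := inner _ _ ^+ 2; set E := sqnorm (y - Phi *m w); set D := 1 + _.
have D0 : 0 < D by rewrite /D; have := ric_ge0 Phi 1; lra.
have gR : 0 < g%:R :> R by rewrite ltr0n.
move=> step excess.
have {}excess : (sqnorm (r l) - E) * (1 - d) / g%:R <= p.
  by rewrite ler_pdivrMr //; lra.
have qE : (1 - d) / (D * g%:R) * (sqnorm (r l) - E) =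
    (sqnorm (r l) - E) * (1 - d) / g%:R / D by field; rewrite !gt_eqF.
suff : (sqnorm (r l) - E) * (1 - d) / g%:R / D <= p / D.
  by rewrite -qE; set b := _ / (D * _); lra.
by rewrite ler_wpM2r // invr_ge0 ltW.
Qed.

(** Against a fixed competitor, [h] contractions leave a factor [(1 - b) ^+ h <= expR (- (h%:R * b))
    <= eta] of the excess. *)
Lemma residual_phase (k h g : nat) (w : 'cV[R]_n) (d a eta : R) :
  0 <= d -> d < 1 -> (0 < g)%N -> 0 <= a -> a * g%:R <= h%:R ->
  (#|supp w :\: Tset t k| <= g)%N ->
  (forall l, (l < k + h)%N ->
    (1 - d) * sqnorm (w - u l) <= sqnorm (Phi *m (w - u l))) ->
  eta = expR (- (a * (1 - d) / (1 + ric Phi 1))) ->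
  sqnorm (r (k + h)) <=
    (1 - eta) * sqnorm (y - Phi *m w) + eta * sqnorm (r k).
Proof.
move=> d0 d1 g0 a0 agh cardw rip etaE.
set E := sqnorm (y - Phi *m w); set D := 1 + ric Phi 1 in etaE *.
have D1 : 1 <= D by rewrite /D; have := ric_ge0 Phi 1; lra.
have D0 : 0 < D by lra.
have gR : 1 <= g%:R :> R by rewrite ler1n.
have gR0 : 0 < g%:R :> R by lra.
have Dg : 1 <= D * g%:R := mulr_ege1 D1 gR.
pose b := (1 - d) / (D * g%:R).
have b1 : b <= 1 by rewrite /b ler_pdivrMr; lra.
have iter j : (j <= h)%N ->
    sqnorm (r (k + j)) - E <= (1 - b) ^+ j * (sqnorm (r k) - E).
  elim: j => [_|j IH jh]; first by rewrite addn0 mul1r.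
  have sub : (#|supp w :\: Tset t (k + j)| <= g)%N.
    apply: leq_trans cardw; apply: subset_leq_card.
    by apply: finset.setDS; apply: Tset_subset; exact: leq_addr.
  have kj : (k + j < k + h)%N by rewrite ltn_add2l.
  have := residual_contraction d1 g0 sub (rip _ kj).
  rewrite addnS -/E -/D -/b => /le_trans; apply.
  rewrite exprS -mulrA; apply: ler_wpM2l; [lra|exact: IH (ltnW jh)].
have eta1 : eta <= 1.
  rewrite etaE expR_le1 oppr_le0 divr_ge0 //; last by lra.
  by rewrite mulr_ge0 //; lra.
(* If the residual already beats the competitor, monotonicity suffices, since the convex combination
   is then at least [sqnorm (r k)]. *)
have [rE|Er] := leP (sqnorm (r k)) E.
  have := residual_decr (leq_addr h k).
  have : 0 <= (1 - eta) * (E - sqnorm (r k)) by apply: mulr_ge0; lra.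
  lra.
have := iter h (leqnn h).
suff q : (1 - b) ^+ h <= eta.
  have rE0 : 0 <= sqnorm (r k) - E by lra.
  have := ler_wpM2r rE0 q; lra.
apply: le_trans (_ : expR (- b) ^+ h <= _).
  apply: lerXn2r; last exact: expR_ge1Dx; rewrite nnegrE ?expR_ge0 //; lra.
rewrite etaE -expRM_natl ler_expR mulrN lerN2.
have -> : h%:R * b = (1 - d) / D * (h%:R / g%:R).
  by rewrite /b; field; rewrite !gt_eqF.
have -> : a * (1 - d) / D = (1 - d) / D * a by field; rewrite gt_eqF.
apply: ler_wpM2l; first by rewrite divr_ge0 //; lra.
by rewrite ler_pdivlMr.
Qed.

End Run.

(** * Energy left after removing the heaviest elements *)

Section LightSubset.
Variables (R : realType) (I : finType) (f : I -> R) (G : {set I}).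
Hypothesis f_ge0 : forall i, 0 <= f i.

(* [light_subset g] is what is left of [G] after removing (at most) its [g]
   heaviest elements. *)
Definition light_subset (g : nat) : {set I} :=
  [arg min_(A < G | (A \subset G) && (#|G| <= #|A| + g)%N) \sum_(i in A) f i]%O.

Definition light_weight (g : nat) : R := \sum_(i in light_subset g) f i.

Lemma light_subsetP (g : nat) :
  [/\ light_subset g \subset G, (#|G| <= #|light_subset g| + g)%N &
    forall A : {set I}, A \subset G -> (#|G| <= #|A| + g)%N ->
      light_weight g <= \sum_(i in A) f i].
Proof.
rewrite /light_weight /light_subset; case: arg_minP => [|A /andP[AG cA] Amin].
  by rewrite fintype.subxx leq_addr.
by split=> // B BG cB; apply: Amin; rewrite BG.
Qed.

Lemma light_weight_ge0 (g : nat) : 0 <= light_weight g.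
Proof. by apply: sumr_ge0 => i _. Qed.

Lemma light_weight_eq0 (g : nat) : (#|G| <= g)%N -> light_weight g = 0.
Proof.
move=> Gg; have [_ _ /(_ finset.set0)] := light_subsetP g.
rewrite finset.sub0set cards0 add0n big_set0 => /(_ isT Gg) le0.
by apply/eqP; rewrite eq_le le0 light_weight_ge0.
Qed.

Lemma light_subset0 : light_subset 0 = G.
Proof.
have [sub card _] := light_subsetP 0.
by apply/eqP; rewrite eqEcard sub; rewrite addn0 in card.
Qed.

(** A set lighter than the minimum cannot be admissible, so it has too few elements. *)
Lemma light_weight_gt (g : nat) (A : {set I}) :
  A \subset G -> \sum_(i in A) f i < light_weight g -> (#|A| + g < #|G|)%N.
Proof.
move=> AG; have [_ _ /(_ A AG) Amin] := light_subsetP g.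
by apply: contraTltn => /Amin; rewrite leNgt.
Qed.

End LightSubset.

(* Hermite's identity [floor (2 z) = floor z + floor (z + 1/2)]. *)
Lemma truncn_double (R : realType) (z : R) : 0 <= z ->
  (Num.truncn z)%:R + (z - 2^-1) <= (Num.truncn (2 * z))%:R.
Proof.
move=> z0; have /andP[+ +] := truncn_itv z0; set p := Num.truncn z.
have z20 : 0 <= 2 * z by lra.
rewrite -natr1 => lo hi; have [small|big] := ltP z (p%:R + 2^-1).
  suff : (2 * p <= Num.truncn (2 * z))%N by rewrite -(ler_nat R) natrM; lra.
  by rewrite truncn_ge_nat // natrM; lra.
suff : (2 * p + 1 <= Num.truncn (2 * z))%N.
  by rewrite -(ler_nat R) natrD natrM; lra.
by rewrite truncn_ge_nat // natrD natrM; lra.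
Qed.

(** * Recovery of the support, one group of phases at a time *)

Section Recovery.
Variables (R : realType) (m n : nat) (Phi : 'M[R]_(m, n)) (x : 'cV[R]_n).
Variables (t : nat -> 'I_n) (u : nat -> 'cV[R]_n).
Hypothesis run : omp_run Phi (Phi *m x) t u.
Let T := supp x.
Let G k := T :\: Tset t k.

Definition restr (A : {set 'I_n}) : 'cV[R]_n :=
  \col_i (if i \in A then x i 0 else 0).

Lemma sqnorm_restr (A : {set 'I_n}) :
  sqnorm (restr A) = \sum_(i in A) x i 0 ^+ 2.
Proof.
rewrite /sqnorm [RHS]big_mkcond; apply: eq_bigr => i _.
by rewrite mxE; case: ifP; rewrite ?expr0n.
Qed.

Lemma supp_restr (A : {set 'I_n}) : supp (restr A) \subset A.
Proof.
by apply/fintype.subsetP => i; rewrite inE mxE; case: ifP; rewrite ?eqxx.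
Qed.

Lemma supp_sub_restr (A : {set 'I_n}) : supp (x - restr A) \subset T :\: A.
Proof.
apply/fintype.subsetP => i; rewrite !inE !mxE.
by case: ifP; rewrite ?subrr ?eqxx ?subr0.
Qed.

Lemma mul_sub_restr (A : {set 'I_n}) :
  Phi *m x - Phi *m (x - restr A) = Phi *m restr A.
Proof. by rewrite mulmxBr opprB addrCA subrr addr0. Qed.

(* [L] is the first index at which the remaining energy drops by the factor
   [2 eta]; phase [i] ends at iteration [k + K i], and Hermite's identity makes
   it long enough to contract the residual by [eta]. *)
Lemma omp_progress (k : nat) (c d D eta : R) :
  2 <= c -> 0 <= d -> d < 1 -> 0 < D ->
  eta = expR (- (c / 4 * (1 - d) / (1 + ric Phi 1))) -> eta <= 2^-1 ->
  4 * eta * (1 - eta) * D <= 1 - d ->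
  (forall (l : nat) (v : 'cV[R]_n), l%:R <= k%:R + c * #|G k|%:R ->
    supp v \subset T :|: Tset t l -> (1 - d) * sqnorm v <= sqnorm (Phi *m v)) ->
  (forall v : 'cV[R]_n, supp v \subset G k ->
    sqnorm (Phi *m v) <= D * sqnorm v) ->
  (0 < #|G k|)%N ->
  exists k' M : nat, [/\ (k <= k')%N, (0 < M)%N, k'%:R <= k%:R + c * M%:R &
    (#|G k'| + M <= #|G k|)%N].
Proof.
move=> c2 d0 d1 D0 etaE eta2 etaD lower upper G0.
have eta0 : 0 < eta by rewrite etaE expR_gt0.
pose f i := x i 0 ^+ 2.
have f0 i : 0 <= f i by exact: sqr_ge0.
pose A i := light_subset f (G k) (2 ^ i - 1).
pose e i := light_weight f (G k) (2 ^ i - 1).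
have e_ge0 i : 0 <= e i by exact: light_weight_ge0.
have e0 : 0 < e 0%N.
  rewrite /e /light_weight expn0 subnn light_subset0.
  have [i iG] := card_gt0P G0; rewrite (bigD1 i) //=.
  apply: ltr_pwDl; last by apply: sumr_ge0.
  by move: iG; rewrite !inE => /andP[_ xi]; rewrite /f lt_def sqrf_eq0 xi sqr_ge0.
(* Without such a drop every [e i] would be positive, yet [e i] vanishes once
   [2 ^ i - 1 >= #|G k|]. *)
have exL : exists L, e L.+1 < 2 * eta * e L.
  apply/not_existsP => noL.
  have e_gt0 i : 0 < e i.
    elim: i => // i IH; have /negP := noL i; rewrite -leNgt; apply: lt_le_trans.
    by rewrite !mulr_gt0.
  have := e_gt0 #|G k|; rewrite /e light_weight_eq0 ?ltxx //.
  by rewrite leq_subRL ?expn_gt0 // add1n ltn_expl.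
have [L eL Lmin] := ex_minnP exL.
have eL0 : 0 < e L.
  have eta20 : 0 < 2 * eta by lra.
  by rewrite -(pmulr_rgt0 _ eta20); apply: le_lt_trans eL.
have e_step i : (i < L)%N -> 2 * eta * e i <= e i.+1.
  by move=> iL; rewrite leNgt; apply/negP => /Lmin; rewrite leqNgt iL.
(* Positive energy means that [2 ^ L - 1] removals do not exhaust [G k]; this keeps all phases
   within the iteration budget. *)
have LG : (2 ^ L <= #|G k|)%N.
  have : ~~ (#|G k| <= 2 ^ L - 1)%N.
    by apply/negP => /(light_weight_eq0 f0) eq0; move: eL0; rewrite /e eq0 ltxx.
  by rewrite -ltnNge ltn_subLR ?expn_gt0 // add1n ltnS.
pose K i := Num.truncn (c / 4 * 2 ^+ i.+1).
have z0 i : 0 <= c / 4 * 2 ^+ i.+1.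
  by rewrite mulr_ge0 ?exprn_ge0 //; lra.
have zS i : c / 4 * 2 ^+ i.+2 = 2 * (c / 4 * 2 ^+ i.+1) by rewrite exprS mulrCA.
have K_le i j : (i <= j)%N -> (K i <= K j)%N.
  move=> ij; apply: le_truncn; apply: ler_wpM2l; first by lra.
  by rewrite ler_weXn2l // ler1n.
have KL : (K L.+1)%:R <= c * (2 ^ L)%:R :> R.
  apply: le_trans (_ : c / 4 * 2 ^+ L.+2 <= _); first by rewrite truncn_le.
  by rewrite natrX !exprS; lra.
pose rho i := sqnorm (Phi *m x - Phi *m u (k + K i)%N).
have phase i : (i <= L)%N ->
    rho i.+1 <= (1 - eta) * (D * e i.+1) + eta * rho i.
  move=> iL; have [AG cardA _] := light_subsetP f (G k) (2 ^ i.+1 - 1).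
  rewrite -/(A i.+1) in AG cardA.
  have -> : rho i.+1 = sqnorm (Phi *m x - Phi *m u (k + K i + (K i.+1 - K i))%N).
    by rewrite -addnA subnKC // K_le.
  have ub : sqnorm (Phi *m x - Phi *m (x - restr (A i.+1))) <= D * e i.+1.
    rewrite mul_sub_restr /e /light_weight -sqnorm_restr; apply: upper.
    exact: fintype.subset_trans (supp_restr _) AG.
  apply: le_trans (lerD (ler_wpM2l _ ub) (lexx _)); last by lra.
  apply: (residual_phase run d0 d1 _ _ _ _ _ etaE (g := 2 ^ i.+1 - 1)).
  - by rewrite subn_gt0 -{1}(expn0 2) ltn_exp2l.
  - by lra.
  - rewrite natrB ?expn_gt0 // natrB ?K_le // natrX.
    (* Rounding loses at most [1/2], which [c / 4 >= 1/2] absorbs because [g] is [2 ^ i.+1 - 1]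
       rather than [2 ^ i.+1]. *)
    have := truncn_double (z0 i); rewrite -zS -/(K i) -/(K i.+1).
    lra.
  - rewrite -(leq_add2l #|A i.+1|).
    apply: leq_trans cardA; rewrite -(cardsID (A i.+1) (G k)).
    rewrite (finset.setIidPr AG) leq_add2l; apply: subset_leq_card.
    apply/fintype.subsetP => j; rewrite finset.in_setD => /andP[jT].
    move/(fintype.subsetP (supp_sub_restr _)).
    rewrite !finset.in_setD => /andP[-> ->]; rewrite andbT /=.
    by apply: contra jT; apply/fintype.subsetP/Tset_subset/leq_addr.
  move=> l; rewrite -addnA subnKC ?K_le // => lk; apply: (lower l).
    have lK : (l <= k + K L.+1)%N.
      by apply: leq_trans (ltnW lk) _; rewrite leq_add2l K_le.
    apply: le_trans (_ : (k + K L.+1)%:R <= _); first by rewrite ler_nat.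
    by rewrite natrD lerD2l (le_trans KL) // ler_wpM2l ?ler_nat //; lra.
  apply/fintype.subsetP => j; rewrite finset.in_setU; apply: contraLR.
  rewrite negb_or => /andP[jT jNl]; rewrite inE negbK !mxE.
  rewrite (run_eq0 run jNl).
  move: jT; rewrite inE negbK => /eqP ->.
  by case: ifP; rewrite !subrr.
(* The first [K 0] iterations enter only through monotonicity. *)
have rho0 : rho 0%N <= D * e 0%N.
  apply: le_trans (residual_decr run (leq_addr _ _)) _.
  have [_ min_k _] := run k.
  apply: le_trans (min_k (x - restr (G k)) _) _.
    apply: fintype.subset_trans (supp_sub_restr _) _.
    by rewrite finset.setDDr finset.setDv finset.set0U finset.subsetIr.
  rewrite mul_sub_restr /e /light_weight expn0 subnn light_subset0 -sqnorm_restr.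
  by apply: upper; exact: supp_restr.
have rho_le i : (i <= L)%N -> rho i <= 2 * (1 - eta) * (D * e i).
  elim: i => [_|i IH iL].
    apply: le_trans rho0 _; rewrite -[leLHS]mul1r; apply: ler_wpM2r; last by lra.
    by rewrite mulr_ge0 ?ltW.
  have := phase _ (ltnW iL); have := IH (ltnW iL).
  move/(ler_wpM2l (ltW eta0)).
  have etaD0 : 0 <= (1 - eta) * D by rewrite mulr_ge0 ?ltW //; lra.
  have := ler_wpM2l etaD0 (e_step _ iL); lra.
have rhoL : rho L.+1 < (1 - d) * e L.
  have := phase _ (leqnn L); have := rho_le _ (leqnn L).
  move/(ler_wpM2l (ltW eta0)).
  have etaD0 : 0 < (1 - eta) * D by rewrite mulr_gt0 //; lra.
  have := eL; rewrite -(ltr_pM2l etaD0).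
  have := ler_wpM2r (ltW eL0) etaD; lra.
exists (k + K L.+1)%N, (2 ^ L)%N; split; rewrite ?leq_addr ?expn_gt0 //.
  by rewrite natrD lerD2l.
have sub : G (k + K L.+1) \subset G k.
  by apply: finset.setDS; apply: Tset_subset; exact: leq_addr.
(* The missed energy is too small for [#|G k| - (2 ^ L - 1)] indices, so at least [2 ^ L] of them
   have been selected. *)
suff /(light_weight_gt sub) : \sum_(i in G (k + K L.+1)%N) f i < e L.
  by rewrite addnBA ?expn_gt0 // subn1 -ltnS prednK // addn_gt0 expn_gt0 orbT.
set k' := (k + K L.+1)%N in rhoL *.
have low : (1 - d) * sqnorm (x - u k') <= rho L.+1.
  rewrite /rho -mulmxBr; apply: (lower k').
    by rewrite natrD lerD2l (le_trans KL) // ler_wpM2l ?ler_nat //; lra.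
  apply/fintype.subsetP => j; rewrite finset.in_setU; apply: contraLR.
  rewrite negb_or => /andP[jT jk']; rewrite inE negbK !mxE.
  by move: jT; rewrite inE negbK (run_eq0 run jk') => /eqP ->; rewrite subrr.
have d1' : 0 < 1 - d by lra.
rewrite -(ltr_pM2l d1'); apply: le_lt_trans rhoL; apply: le_trans low.
rewrite ler_pM2l // /sqnorm big_mkcond; apply: ler_sum => i _.
case: ifP => [|_]; last exact: sqr_ge0.
rewrite finset.in_setD => /andP[ik' _]; rewrite /f !mxE.
by rewrite (run_eq0 run ik') subr0.
Qed.

(** Progress can be repeated: the deadline [k + c * #|G k|] never increases and [G k] shrinks, so
    both isometry hypotheses carry over with the same [d] and [D]. *)
Lemma omp_recovery (k : nat) (c d D eta : R) :
  2 <= c -> 0 <= d -> d < 1 -> 0 < D ->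
  eta = expR (- (c / 4 * (1 - d) / (1 + ric Phi 1))) -> eta <= 2^-1 ->
  4 * eta * (1 - eta) * D <= 1 - d ->
  (forall (l : nat) (v : 'cV[R]_n), l%:R <= k%:R + c * #|G k|%:R ->
    supp v \subset T :|: Tset t l -> (1 - d) * sqnorm v <= sqnorm (Phi *m v)) ->
  (forall v : 'cV[R]_n, supp v \subset G k ->
    sqnorm (Phi *m v) <= D * sqnorm v) ->
  exists2 l : nat, l%:R <= k%:R + c * #|G k|%:R & T \subset Tset t l.
Proof.
move=> c2 d0 d1 D0 etaE eta2 etaD.
move: {2}#|G k| (leqnn #|G k|) => N.
elim: N k => [|N IH] k GN lower upper.
  exists k; first by rewrite lerDl mulr_ge0 //; lra.
  by rewrite -finset.setD_eq0 -cards_eq0 -leqn0.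
have [G0|G0] := leqP #|G k| 0; first by apply: IH => //; exact: leq_trans G0 _.
have [k' [M [kk' M0 k'M GM]]] :=
  omp_progress c2 d0 d1 D0 etaE eta2 etaD lower upper G0.
have bound : k'%:R + c * #|G k'|%:R <= k%:R + c * #|G k|%:R.
  have : c * (#|G k'| + M)%:R <= c * #|G k|%:R.
    by rewrite ler_wpM2l ?ler_nat //; lra.
  rewrite natrD; lra.
have sub : G k' \subset G k by apply: finset.setDS; exact: Tset_subset.
have [|l v lk'|v vG|l lk' Tl] := IH k'.
- by rewrite -ltnS (leq_trans _ GN) // (leq_trans _ GM) // -addn1 leq_add2l.
- by apply: lower; exact: le_trans bound.
- by apply: upper; exact: fintype.subset_trans sub.
by exists l => //; exact: le_trans bound.
Qed.

End Recovery.

Theorem theorem1 (R : realType) (m n K : nat) (Phi : 'M[R]_(m, n))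
  (x : 'cV[R]_n) (c : R) (t : nat -> 'I_n) (u : nat -> 'cV[R]_n) (k : nat) :
  sparse K x ->
  1 < c ->
  omp_run Phi (Phi *m x) t u ->
  (k%:Z <= Num.ceil (c * K%:R))%R ->
  let T := supp x in
  let Nk := #|T :\: Tset t k| in
  let s := #|T :|: Tset t (k + `|Num.floor (c * Nk%:R)|)%N| in
  ric Phi s < 1 ->
  - (4 * (1 + ric Phi 1) / (1 - ric Phi s)) *
      ln (2^-1 - 2^-1 * Num.sqrt ((ric Phi Nk + ric Phi s) / (1 + ric Phi Nk)))
    <= c ->
  T \subset Tset t (k + `|Num.ceil (c * Nk%:R)|)%N.
Proof.
move=> _ c1 run _ T Nk s ds1 c_ge.
have floorE : `|Num.floor (c * Nk%:R)|%N = Num.truncn (c * Nk%:R).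
  by rewrite truncn_floor mulr_ge0 //; lra.
(* Iteration counts are integers, so the real deadline may be rounded down, matching the floor in
   [s]. *)
have leq_trunc l : l%:R <= k%:R + c * Nk%:R ->
    (l <= k + Num.truncn (c * Nk%:R))%N.
  move=> lk; have [/leq_trans|kl] := leqP l k; first by apply; exact: leq_addr.
  rewrite -leq_subLR truncn_ge_nat ?mulr_ge0 //; last by lra.
  by rewrite natrB ?(ltnW kl) // lerBlDl.
have ceil_ge : (Num.truncn (c * Nk%:R) <= `|Num.ceil (c * Nk%:R)|)%N.
  rewrite -(ler_nat R) natr_absz; apply: le_trans (_ : c * Nk%:R <= _).
    by rewrite truncn_le mulr_ge0 //; lra.
  by rewrite (le_trans (ceil_ge _)) // ler_int ler_norm.
have d0 := ric_ge0 Phi s; have dN0 := ric_ge0 Phi Nk; have d10 := ric_ge0 Phi 1.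
move: c_ge; set d := ric Phi s in ds1 d0 *; set dN := ric Phi Nk in dN0 *.
set d1 := ric Phi 1 in d10 *; set rho := (dN + d) / _; set b := _ / (1 - d).
move=> c_ge.
have rho0 : 0 <= rho by rewrite divr_ge0; lra.
have rho1 : Num.sqrt rho < 1.
  by rewrite -[1]sqrtr1 ltr_sqrt // /rho ltr_pdivrMr; lra.
have sqrt0 := sqrtr_ge0 rho.
pose eta := expR (- (c / 4 * (1 - d) / (1 + d1))).
have b4 : 4 <= b by rewrite /b ler_pdivlMr; lra.
have etaE : eta = expR (- (c / b)).
  by congr (expR (- _)); rewrite /b; field; rewrite !gt_eqF //; lra.
have eta_le : eta <= 2^-1 - 2^-1 * Num.sqrt rho.
  rewrite -[leRHS]lnK ?posrE; last by lra.
  rewrite etaE ler_expR lerNl ler_pdivlMr; last by lra.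
  by move: c_ge; set q := ln _; lra.
(* From [1 - c / b <= eta <= 1/2] follows [c >= b / 2], and [b >= 4]. *)
have c2 : 2 <= c.
  have := expR_ge1Dx (- (c / b)); rewrite -etaE => eta_ge.
  have : 2^-1 <= c / b by lra.
  rewrite ler_pdivlMr; lra.
(* Square [Num.sqrt rho <= 1 - 2 * eta] and clear the denominator [1 + dN]. *)
have quad : 4 * eta * (1 - eta) * (1 + dN) <= 1 - d.
  have rho_le : rho <= (1 - 2 * eta) ^+ 2.
    by rewrite -[leLHS]sqr_sqrtr // ler_sqr ?nnegrE; lra.
  have : rho * (1 + dN) <= (1 - 2 * eta) ^+ 2 * (1 + dN).
    by rewrite ler_wpM2r; lra.
  rewrite /rho divfK ?gt_eqF; lra.
have D0 : 0 < 1 + dN by lra.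
have eta2 : eta <= 2^-1 by lra.
have [l v lk vT|v vG|l lk Tl] :=
  omp_recovery run (k := k) c2 d0 ds1 D0 (erefl eta) eta2 quad.
- suff /(ric_bounds Phi) [] : sparse s v by [].
  apply: leq_trans (subset_leq_card vT) _; apply: subset_leq_card.
  by apply: finset.setUS; apply: Tset_subset; rewrite floorE leq_trunc.
- have /(ric_bounds Phi) [] : sparse Nk v by exact: subset_leq_card.
  by [].
apply: fintype.subset_trans Tl _; apply: Tset_subset.
by apply: leq_trans (leq_trunc _ lk) _; rewrite leq_add2l.
Qed.
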